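(* Let $m\geq 2$ be an even integer, let $K$ be a totally real infinite extension of $\mathbb{Q}$, let $\delta\in\mathcal{O}_K^+$, and let $\mathcal{O}$ be an order in $K$. If there exists a totally positive definite $m$-ic $\mathcal{O}$-lattice that represents all elements of $\delta\mathcal{O}^+=\{\delta\beta:\beta\in\mathcal{O}^+\}$, then $\mathcal{O}^+$ does not have the Northcott property.
   Context: All extensions of $\mathbb{Q}$ are algebraic. An algebraic extension $K/\mathbb{Q}$ is totally real if for every $\alpha\in K$ all embeddings of $\mathbb{Q}(\alpha)$ into $\mathbb{C}$ have image in $\mathbb{R}$; ''infinite'' means $[K:\mathbb{Q}]=\infty$. An element $\alpha\in K$ is totally positive if $\sigma(\alpha)>0$ for all embeddings $\sigma:\mathbb{Q}(\alpha)\to\mathbb{R}$; $S^+$ denotes the set of totally positive elements of $S\subseteq K$. $\mathcal{O}_K$ is the ring of algebraic integers in $K$. An order in $K$ is a subring $\mathcal{O}\subseteq\mathcal{O}_K$ with fraction field $K$. The house of $\alpha\in K$ is $\max_\sigma|\sigma(\alpha)|$ over all embeddings $\sigma:\mathbb{Q}(\alpha)\to\mathbb{R}$. A subset $S\subseteq\mathcal{O}_K$ has the Northcott property (with respect to the house) if for every real $c>0$ there are only finitely many elements of $S$ whose house is less than $c$. $m$-ic forms: Let $V$ be a finite-dimensional $K$-vector space. An $m$-ic form on $V$ is a map $Q:V\to K$ with $Q(av)=a^mQ(v)$ for all $a\in K$, $v\in V$ and such that the map $M_Q(v_1,\dots,v_m)=\frac{1}{m!}\sum_{I\subseteq\{1,\dots,m\}}(-1)^{m-|I|}Q\left(\sum_{i\in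 I}v_i\right)$ (an empty sum being $0$) is $K$-multilinear. In coordinates, $Q$ is given by a homogeneous polynomial of degree $m$. An $m$-ic $\mathcal{O}$-lattice $(\Lambda,Q)$ is a finitely generated $\mathcal{O}$-submodule $\Lambda\subseteq V$ of a finite-dimensional $K$-vector space $V$ (which may be taken to be the $K$-span of $\Lambda$), together with (the restriction of) an $m$-ic form $Q:V\to K$; it is always assumed integral, i.e. $Q(\Lambda)\subseteq\mathcal{O}$. It represents $\alpha$ if $Q(v)=\alpha$ for some $v\in\Lambda$. It is totally positive definite if for every embedding $\sigma:K\to\mathbb{R}$ the real form $\sigma(Q)$ on $V\otimes_{K,\sigma}\mathbb{R}$ obtained by applying $\sigma$ to the coefficients of $Q$ takes strictly positive values on all nonzero vectors. *)

(* Defs.v *)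
From HB Require Import structures.
From mathcomp Require Import all_boot all_order all_algebra.
From mathcomp Require Import boolp classical_sets cardinality reals.
From mathcomp Require Import complex.
From mathcomp Require Import mpoly.

Set Implicit Arguments.
Unset Strict Implicit.
Unset Printing Implicit Defensive.

Import Order.TTheory GRing.Theory Num.Theory.

Local Open Scope ring_scope.
Local Open Scope classical_set_scope.

(* The subfield Q(a) generated by a (every subfield contains Q). *)
Definition adjoin (K : fieldType) (a : K) : {pred K} :=
  fun x => `[< forall S : {pred K}, divring_closed S -> a \in S -> x \in S >].

Lemma adjoin_divring_closed (K : fieldType) (a : K) : divring_closed (adjoin a).
Proof.
split=> [|x y /asboolP Hx /asboolP Hy|x y /asboolP Hx /asboolP Hy];
  apply/asboolP=> S clS aS; have [S1 SB SV] := clS; first exact: S1.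
- by apply: SB; [exact: Hx | exact: Hy].
- by apply: SV; [exact: Hx | exact: Hy].
Qed.

HB.instance Definition _ (K : fieldType) (a : K) :=
  GRing.isDivringClosed.Build K (adjoin a) (adjoin_divring_closed a).

Record Qadj (K : fieldType) (a : K) :=
  MkQadj { Qadj_val : K; _ : Qadj_val \in adjoin a }.

HB.instance Definition _ (K : fieldType) (a : K) :=
  [isSub for @Qadj_val K a].
HB.instance Definition _ (K : fieldType) (a : K) :=
  [Choice of Qadj a by <:].
HB.instance Definition _ (K : fieldType) (a : K) :=
  [SubChoice_isSubIntegralDomain of Qadj a by <:].
HB.instance Definition _ (K : fieldType) (a : K) :=
  [SubIntegralDomain_isSubField of Qadj a by <:].

Lemma adjoin_gen (K : fieldType) (a : K) : a \in adjoin a.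
Proof. by apply/asboolP=> S _. Qed.

Definition Qgen (K : fieldType) (a : K) : Qadj a := MkQadj (adjoin_gen a).

(* An extension K/Q is a field K with a ring morphism iota : rat -> K, which
   is then unique and forces K to have characteristic 0. *)
Definition algebraic_ext (K : fieldType) (iota : {rmorphism rat -> K}) : Prop :=
  forall a : K, algebraicOver iota a.

Definition totally_real (R : realType) (K : fieldType)
    (iota : {rmorphism rat -> K}) : Prop :=
  algebraic_ext iota /\
  forall (a : K) (s : {rmorphism Qadj a -> R[i]}) (x : Qadj a),
    exists r : R, s x = real_complex R r.

Definition finite_ext (K : fieldType) (iota : {rmorphism rat -> K}) : Prop :=
  exists (n : nat) (e : 'I_n -> K),
    forall a : K, exists c : 'I_n -> rat, a = \sum_(i < n) iota (c i) * e i.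

Definition infinite_ext (K : fieldType) (iota : {rmorphism rat -> K}) : Prop :=
  ~ finite_ext iota.

Definition integers (K : fieldType) : set K :=
  [set a | integralOver (intr : int -> K) a].
Arguments integers K : clear implicits.

Definition totally_positive (R : realType) (K : fieldType) (a : K) : Prop :=
  forall s : {rmorphism Qadj a -> R}, 0 < s (Qgen a).

Definition pos_part (R : realType) (K : fieldType) (S : set K) : set K :=
  [set a | S a /\ totally_positive R a].

(* For a in a totally real field there are finitely many, and at least one,
   embeddings of Q(a) into R, so this supremum is a maximum. *)
Definition house (R : realType) (K : fieldType) (a : K) : R :=
  sup [set r | exists s : {rmorphism Qadj a -> R}, r = `|s (Qgen a)|].

Definition northcott (R : realType) (K : fieldType) (S : set K) : Prop :=
  forall c : R, 0 < c -> finite_set [set a | S a /\ house R a < c].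

Definition is_order (K : fieldType) (Ord : {pred K}) : Prop :=
  [/\ subring_closed Ord,
      [set` Ord] `<=` integers K
    & forall x : K, exists a b, [/\ a \in Ord, b \in Ord, b != 0 & x = a / b]].

Definition multilinear (m : nat) (K : fieldType) (V : lmodType K)
    (M : ('I_m -> V) -> K) : Prop :=
  forall (i : 'I_m) (v : 'I_m -> V),
    scalar (fun x : V => M (fun j => if j == i then x else v j)).

Definition polarization (m : nat) (K : fieldType) (V : lmodType K)
    (Q : V -> K) (v : 'I_m -> V) : K :=
  (m`!%:R)^-1 *
  \sum_(I : {set 'I_m}) (-1) ^+ (m - #|I|) * Q (\sum_(i in I) v i).

Definition mic_form (m : nat) (K : fieldType) (V : lmodType K)
    (Q : V -> K) : Prop :=
  (forall (a : K) (v : V), Q (a *: v) = a ^+ m * Q v) /\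
  multilinear (@polarization m K V Q).

(* The finitely generated Ord-submodules of V are the sets of Ord-linear
   combinations of finite families e. *)
Definition fg_submodule (K : fieldType) (Ord : {pred K}) (V : lmodType K)
    (L : set V) : Prop :=
  exists (n : nat) (e : 'I_n -> V),
    L = [set v | exists c : 'I_n -> K,
           (forall i, c i \in Ord) /\ v = \sum_(i < n) c i *: e i].

Definition mic_lattice (m : nat) (K : fieldType) (Ord : {pred K})
    (V : vectType K) (L : set V) (Q : V -> K) : Prop :=
  [/\ fg_submodule Ord L, mic_form m Q & forall v, L v -> Q v \in Ord].

Definition represents (K : fieldType) (V : vectType K) (L : set V)
    (Q : V -> K) (a : K) : Prop :=
  exists2 v, L v & Q v = a.

(* P is the expression of Q in the coordinates of the chosen basis of V. *)
Definition coord_poly (m : nat) (K : fieldType) (V : vectType K) (Q : V -> K)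
    (P : {mpoly K[\dim {:V}]}) : Prop :=
  P \is m.-homog /\
  forall x : 'I_(\dim {:V}) -> K,
    Q (\sum_i x i *: (vbasis {:V})`_i) = P.@[x].

(* The basis of V identifies V (x)_(K, s) R with R^(dim V), and s(Q) with the
   polynomial obtained by applying s to the coefficients of P, which Q
   determines uniquely because K is infinite. *)
Definition totally_posdef (R : realType) (m : nat) (K : fieldType)
    (V : vectType K) (Q : V -> K) : Prop :=
  exists2 P : {mpoly K[\dim {:V}]}, coord_poly m Q P &
    forall (s : {rmorphism K -> R}) (x : 'I_(\dim {:V}) -> R),
      (exists i, x i != 0) -> 0 < (map_mpoly s P).@[x].

(* Main.v *)
From HB Require Import structures.
Require Import Defs.
From mathcomp Require Import all_boot all_order all_algebra.
From mathcomp Require Import boolp classical_sets cardinality reals.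
From mathcomp Require Import polyrcf complex mpoly zify ring lra.
From mathcomp Require Import topology normedtype derive realfun.

(** The proof is a descent on the size of elements under all embeddings.

    Write P for the form Q in coordinates, of degree m. The coefficients of P
    are algebraic, so only finitely many polynomials s(P) occur when s runs
    over the embeddings of K into R. Each of them is positive on the compact
    unit sphere, so a single constant C > 0 satisfies
    C |s(x_i)|^m <= s(P(x)) for all s, x and i
    ([totally_posdef_lower_bound]). Let d in the order be a common denominator
    for the coordinates of lattice vectors. If a totally positive a of the
    order satisfies |s(a)| <= H for all s, then delta a = P(x) with every d x_i
    in the order, and |s(d x_i)|^m is at most a constant times H. As m >= 2,
    for large H this gives |s(d x_i)| <= H/3, so with an integer N just above
    H/3 the element N + d x_i is totally positive and its conjugates are
    smaller than H by at least 1.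

    Let F be a subfield of K containing delta, d and the coefficients of P. If
    a is not in F then some d x_i is not in F either, so the descent never
    enters F. It stops at a bound B that does not depend on F: every such
    F <> K misses a totally positive element of the order of house at most B
    ([small_totally_positive_outside]). If the set of totally positive elements
    of the order of house < B + 1 were finite, then F could be chosen to
    contain it while being of finite degree over Q, hence different from K
    ([infinite_ext_proper_subfield]), which is a contradiction.

    The house and total positivity of a refer to embeddings of Q(a), whereas
    positive definiteness refers to embeddings of K. They are reconciled by
    [real_embedding_extends]: since K is algebraic over Q, every embedding of
    Q(a) extends to K with values in the algebraically closed field R[i], and
    since K is totally real these values are real. *)

Set Implicit Arguments.
Unset Strict Implicit.
Import Order.TTheory GRing.Theory Num.Theory.
Import numFieldNormedType.Exports.
Local Open Scope ring_scope.
Local Open Scope classical_set_scope.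

(** * Homogeneous forms positive off the origin *)

Lemma meval_homogZ (R : comNzRingType) (n m : nat) (p : {mpoly R[n]})
    (t : R) (y : 'I_n -> R) :
  p \is m.-homog -> p.@[fun i => t * y i] = t ^+ m * p.@[y].
Proof.
move=> /dhomogP hp; rewrite !mevalE mulr_sumr.
rewrite big_seq [RHS]big_seq; apply: eq_bigr => k /hp /= hk.
under eq_bigr => i _ do rewrite exprMn.
by rewrite big_split /= prodrXr -mdegE hk mulrCA.
Qed.

Lemma meval_rV_continuous (R : realType) (n : nat) (p : {mpoly R[n]}) :
  continuous (fun y : 'rV[R]_n => p.@[fun i => y ord0 i]).
Proof.
suff -> : (fun y : 'rV[R]_n => p.@[fun i => y ord0 i]) =
    fun y => \sum_(k <- msupp p) p@_k * \prod_i y ord0 i ^+ k i.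
  apply: (continuous_big (op := +%R)) => [|k _]; first exact: add_continuous.
  have prod_cont : continuous (fun y : 'rV[R]_n => \prod_i y ord0 i ^+ k i).
    apply: continuous_big => [|i _]; first exact: mul_continuous.
    move=> y; apply: (@continuous_comp _ _ _ (fun z : 'rV[R]_n => z ord0 i)
      (fun x => x ^+ k i)); first exact: coord_continuous.
    exact: exprn_continuous.
  by move=> y; apply: (@cvgM _ _ _ (nbhs_filter y) (fun=> p@_k));
    [exact: cvg_cst|exact: prod_cont].
by apply/funext => y; rewrite mevalE.
Qed.

(** The constant is the minimum of p on the unit sphere of the sup norm, which
    is compact; homogeneity carries the inequality over to all vectors. *)
Lemma posdef_form_lower_bound (R : realType) (n m : nat) (p : {mpoly R[n]}) :
  (0 < m)%N -> p \is m.-homog ->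
  (forall y : 'I_n -> R, (exists i, y i != 0) -> 0 < p.@[y]) ->
  exists2 C : R, 0 < C & forall y i, C * `|y i| ^+ m <= p.@[y].
Proof.
move=> m0 hp pos.
set f := fun y : 'rV[R]_n => p.@[fun i => y ord0 i].
have fE y : p.@[y] = f (\row_i y i).
  by rewrite /f; congr meval; apply/funext => i; rewrite mxE.
have fpos (y : 'rV[R]_n) : y != 0 -> 0 < f y.
  move=> /rV0Pn [i yi]; apply: pos; by exists i.
have norm_coord (y : 'rV[R]_n) i : `|y ord0 i| <= `|y|.
  rewrite [leRHS]mx_normrE.
  exact: (le_bigmax _ (fun ij : 'I_1 * 'I_n => `|y ij.1 ij.2|) (ord0, i)).
pose S := [set y : 'rV[R]_n | `|y| = 1].
have S_neq0 (y : 'rV[R]_n) : S y -> y != 0.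
  by move=> yS; rewrite -normr_eq0 yS oner_eq0.
have Sscale (y : 'rV[R]_n) : y != 0 -> S (`|y|^-1 *: y).
  by move=> y0; rewrite /S /= normrZ normfV normr_id mulVf ?normr_eq0.
(* The sphere is empty when n = 0. *)
have [S0|nS0] := pselect (S !=set0); last first.
  exists 1 => // y i.
  have -> : y i = (\row_j y j) ord0 i by rewrite mxE.
  rewrite fE; have [->|r0] := eqVneq (\row_j y j) 0.
    rewrite mxE normr0 expr0n eqn0Ngt m0 mulr0 /f.
    suff -> : (fun i : 'I_n => (0 : 'rV[R]_n) ord0 i) = fun i => 0 * 0.
      by rewrite (meval_homogZ _ _ hp) expr0n eqn0Ngt m0 mul0r.
    by apply/funext => j; rewrite mxE mul0r.
  by case: nS0; eexists; exact: Sscale r0.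
have cS : compact S.
  apply: bounded_closed_compact.
    exists 1; split=> // M M1 y yS; rewrite /= (_ : `|y| = 1) ?ltW //.
  apply: (@preimage_closed _ _ (fun y : 'rV[R]_n => `|y|) [set 1]); last exact: closed_eq.
  by move=> y _; exact: norm_continuous.
have [y0 /set_mem y0S ymin] :=
  EVT_min_rV S0 cS (continuous_subspaceT (@meval_rV_continuous R n p)).
exists (f y0); first exact: fpos (S_neq0 _ y0S).
move=> y i.
have -> : y i = (\row_j y j) ord0 i by rewrite mxE.
rewrite fE; move: (\row_j y j) => r {y}.
have -> : f r = `|r| ^+ m * f (`|r|^-1 *: r).
  rewrite /f -(meval_homogZ _ _ hp); congr meval; apply/funext => j.
  rewrite mxE mulrA; have [->|r0] := eqVneq r 0; first by rewrite mxE mulr0.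
  by rewrite divff ?mul1r // normr_eq0.
have [->|r0] := eqVneq r 0.
  by rewrite mxE !normr0 !expr0n eqn0Ngt m0 mulr0 mul0r.
rewrite mulrC ler_pM ?exprn_ge0 // ?(ltW (fpos _ (S_neq0 _ y0S))) //.
  by rewrite lerXn2r ?nnegrE.
by apply: ymin; rewrite inE; exact: Sscale.
Qed.

(** * Extension of embeddings *)

(** Writing q = X q1 + c with c <> 0, the equation q(u) = 0 shows that
    - q1(u) / c is the inverse of u. This is used for subrings of K and, to
    invert points of the graph of a partial homomorphism, of K * L. *)
Lemma subring_inverse (A : comNzRingType) (j : {rmorphism rat -> A})
    (G : {pred A}) (u : A) (q : {poly rat}) :
  subring_closed G -> (forall c, j c \in G) -> u \in G ->
  q.[0] != 0 -> root (map_poly j q) u -> exists2 v, v \in G & u * v = 1.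
Proof.
move=> Gring Gj Gu; elim/poly_ind: q => [|q c _]; first by rewrite horner0 eqxx.
rewrite hornerD hornerMX mulr0 add0r hornerC => c0.
rewrite /root rmorphD rmorphM /= map_polyX map_polyC hornerD hornerMX hornerC.
rewrite /= addr_eq0 => /eqP quE.
pose S : subringClosed A := HB.pack G (GRing.isSubringClosed.Build A G Gring).
exists (- j c^-1 * (map_poly j q).[u]).
  rewrite -[G]/(S : {pred A}) rpredM ?rpredN ?Gj // rpred_horner //.
  by apply/polyOverP => i; rewrite coef_map Gj.
by rewrite mulrCA [u * _]mulrC quE mulrNN -rmorphM mulVf ?rmorph1.
Qed.

Lemma algebraic_nonzero_root (K : fieldType) (iota : {rmorphism rat -> K})
    (u : K) :
  algebraicOver iota u -> u != 0 ->
  exists2 q : {poly rat}, q.[0] != 0 & root (map_poly iota q) u.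
Proof.
move=> [p p0 pu] u0; have [k [q qr pE]] := multiplicity_XsubC p 0.
exists q; first by move: qr; rewrite p0.
move: pu; rewrite pE rmorphM rmorphXn rmorphB /= map_polyX map_polyC /= rmorph0.
rewrite subr0 rootM => /orP[//|]; rewrite /root hornerXn expf_eq0.
by rewrite (negbTE u0) andbF.
Qed.

Definition diag_rat (A B : nzRingType) (f : {rmorphism rat -> A})
  (g : {rmorphism rat -> B}) : rat -> A * B := fun c => (f c, g c).

Section DiagRat.
Variables (A B : nzRingType) (f : {rmorphism rat -> A}) (g : {rmorphism rat -> B}).
Fact diag_rat_zmod : zmod_morphism (diag_rat f g).
Proof. by move=> x y; rewrite /diag_rat !rmorphB. Qed.
Fact diag_rat_monoid : monoid_morphism (diag_rat f g).
Proof. by split=> [|x y]; rewrite /diag_rat ?rmorph1 ?rmorphM. Qed.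
HB.instance Definition _ :=
  GRing.isZmodMorphism.Build rat (A * B)%type (diag_rat f g) diag_rat_zmod.
HB.instance Definition _ :=
  GRing.isMonoidMorphism.Build rat (A * B)%type (diag_rat f g) diag_rat_monoid.
End DiagRat.

(** A homomorphism from a subring of K to L is encoded by its graph, a subring
    of K * L. As the graph is an additive group, it suffices that 0 have no
    other value than 0. With graphs, extension of maps is inclusion, as is
    convenient for Zorn's lemma. *)
Definition partial_hom (K L : nzRingType) (G : {pred K * L}) : Prop :=
  subring_closed G /\ forall y, (0, y) \in G -> y = 0.

Section ExtendOne.
Variables (K : fieldType) (L : numClosedFieldType).
Variable iota : {rmorphism rat -> K}.
Let A : comNzRingType := (K * L)%type.
Let j : {rmorphism rat -> A} := diag_rat iota (ratr : {rmorphism rat -> L}).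

Variable G : {pred A}.
Hypotheses (Ghom : partial_hom G) (Grat : forall c, j c \in G).
Let S : subringClosed A :=
  HB.pack G (GRing.isSubringClosed.Build A G (proj1 Ghom)).

Lemma partial_hom_inverse (u : A) :
  algebraicOver iota u.1 -> u \in G -> u != 0 -> exists2 v, v \in G & u * v = 1.
Proof.
move=> ualg Gu u0.
have u10 : u.1 != 0.
  apply: contra_neq u0 => u1; case: u u1 Gu {ualg} => x y /= -> Gu.
  by rewrite (proj2 Ghom y Gu).
have [q q0 qu] := algebraic_nonzero_root ualg u10.
apply: (subring_inverse (proj1 Ghom) Grat Gu q0).
have Gqu : (map_poly j q).[u] \in S.
  by rewrite rpred_horner //; apply/polyOverP => i; rewrite coef_map; exact: Grat.
apply/rootP; case E : ((map_poly j q).[u]) Gqu => [x y].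
have -> : x = 0.
  have -> : x = fst ((map_poly j q).[u]) by rewrite E.
  rewrite -horner_map -map_poly_comp /=; exact/rootP.
by move=> /(proj2 Ghom) ->.
Qed.

(** The value r to be given to b is a root of the image of a minimal polynomial
    of b over the domain of G. A polynomial with coefficients in G carries both
    a polynomial over the domain and its image over L. Take such a polynomial
    vanishing at b in its first component, of least degree; it can be made
    monic. The conclusion says that the graph stays functional once (b, r) is
    adjoined, and follows from Euclidean division by this polynomial. *)
Lemma partial_hom_adjoin (b : K) :
  algebraic_ext iota ->
  exists r : L, forall P : {poly A}, P \is a polyOver G ->
    root (map_poly fst P) b -> P.[(b, r)] = 0.
Proof.
rewrite -[G]/(S : {pred A}).
move=> Kalg.
pose good n := `[< exists P : {poly A}, [/\ P \is a polyOver S, P != 0,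
  root (map_poly fst P) b & size P = n] >].
have ex_good : exists n, good n.
  have [p p0 pb] := Kalg b; exists (size (map_poly j p)); apply/asboolP.
  exists (map_poly j p); split=> //.
  - by apply/polyOverP => i; rewrite coef_map; exact: Grat.
  - apply: contra_neq p0 => /polyP jp; apply/polyP => i; move: (jp i).
    by rewrite coef_map !coef0 => -[/eqP]; rewrite fmorph_eq0 => /eqP.
  - by rewrite -map_poly_comp.
case: (ex_minnP ex_good) => _ /asboolP [P0 [P0S P00 P0b <-]] P0min.
have [v vG lv] : exists2 v, v \in G & lead_coef P0 * v = 1.
  apply: partial_hom_inverse; first exact: Kalg.
    by apply: (polyOverP P0S).
  by rewrite lead_coef_eq0.
pose Q := v *: P0.
have Qb : root (map_poly fst Q) b.
  by rewrite /Q -mul_polyC rmorphM rootM P0b orbT.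
have QS : Q \is a polyOver S by rewrite polyOverZ.
have Qlead : Q`_(size P0).-1 = 1 by rewrite coefZ mulrC.
have sP0 : (0 < size P0)%N by rewrite lt0n size_poly_eq0.
have sQ : size Q = size P0.
  apply/eqP; rewrite eqn_leq size_scale_leq /=.
  rewrite -(prednK sP0) ltnNge; apply/negP => /leq_sizeP /(_ _ (leqnn _)).
  by rewrite Qlead => /eqP; rewrite oner_eq0.
have Qmonic : Q \is monic by rewrite monicE lead_coefE sQ Qlead.
(* Q is monic and vanishes at b in K, so it has positive degree; its image in
   L[X] has the same degree, hence a root. *)
have [r /rootP Qr] : exists r, root (map_poly snd Q) r.
  apply/closed_rootP; rewrite size_map_poly_id0 ?(monicP Qmonic) ?oner_eq0 //.
  apply: contraL Qb => /eqP s1.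
  have -> : Q = 1.
    move: (monicP Qmonic); rewrite lead_coefE s1 /= => Q0.
    by rewrite [Q]size1_polyC ?s1 // Q0.
  by rewrite rmorph1 root1.
(* One step of Euclidean division of P by Q at a time: D cancels the leading
   term of P. *)
exists r => P; have [n] := ubnP (size P); elim: n P => // n IHn P sP PS Pb.
have Qbr : Q.[(b, r)] = 0.
  have Q1 : Q.[(b, r)].1 = 0.
    by rewrite -(rootP Qb); exact/esym/(horner_map fst Q (b, r)).
  have Q2 : Q.[(b, r)].2 = 0.
    by rewrite -Qr; exact/esym/(horner_map snd Q (b, r)).
  by rewrite [LHS]surjective_pairing Q1 Q2.
(* By minimality of the degree of Q, the remainder is 0. *)
have [PltQ|QleP] := ltnP (size P) (size Q).
  have [->|P_neq0] := eqVneq P 0; first by rewrite horner0.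
  have : (size P0 <= size P)%N by apply: P0min; apply/asboolP; exists P.
  by rewrite -sQ leqNgt PltQ.
pose k := (size P - size Q)%N; pose D := lead_coef P *: (Q * 'X^k).
have Dbr : D.[(b, r)] = 0 by rewrite hornerZ hornerM Qbr mul0r mulr0.
have -> : P = (P - D) + D by rewrite subrK.
rewrite hornerD Dbr addr0; apply: IHn.
- have sPgt0 : (0 < size P)%N by rewrite (leq_trans _ QleP) // sQ.
  rewrite -ltnS; apply: leq_trans sP.
  rewrite ltnS -[in X in (_ <= X)%N](prednK sPgt0).
  rewrite ltnS; apply/leq_sizeP => i; rewrite leq_eqVlt => /predU1P[<-|lt_i].
    rewrite coefB coefZ coefMXn /k ifN; last by rewrite -leqNgt; lia.
    have -> : ((size P).-1 - (size P - size Q) = (size P0).-1)%N by lia.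
    by rewrite Qlead mulr1 -lead_coefE subrr.
  rewrite coefB coefZ coefMXn /k ifN; last by rewrite -leqNgt; lia.
  have -> : P`_i = 0 by apply: nth_default; rewrite -(prednK sPgt0).
  have Qi : (size Q <= i - (size P - size Q))%N by lia.
  have -> : Q`_(i - (size P - size Q)) = 0 by apply: nth_default; exact: Qi.
  by rewrite mulr0 subr0.
- by rewrite rpredB // polyOverZ ?(polyOverP PS) // rpredM // polyOverXn.
- rewrite rmorphB /root hornerD (rootP Pb) add0r hornerN oppr_eq0.
  by rewrite /D -mul_polyC !rmorphM !hornerM (rootP Qb) mul0r mulr0.
Qed.
End ExtendOne.

(** The ring G[u]. *)
Definition eval_image (A : comNzRingType) (G : {pred A}) (u : A) : {pred A} :=
  fun x => `[< exists2 P : {poly A}, P \is a polyOver G & x = P.[u] >].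

Lemma eval_imageP (A : comNzRingType) (G : {pred A}) (u x : A) :
  reflect (exists2 P : {poly A}, P \is a polyOver G & x = P.[u])
    (x \in eval_image G u).
Proof. exact: asboolP. Qed.

Lemma eval_image_subring (A : comNzRingType) (G : {pred A}) (u : A) :
  subring_closed G ->
  [/\ subring_closed (eval_image G u), {subset G <= eval_image G u}
    & u \in eval_image G u].
Proof.
move=> Gring.
pose S : subringClosed A := HB.pack G (GRing.isSubringClosed.Build A G Gring).
rewrite -[G]/(S : {pred A}); split; first split.
- by apply/eval_imageP; exists 1; rewrite ?rpred1 ?hornerC.
- move=> x y /eval_imageP[P PS ->] /eval_imageP[Q QS ->]; apply/eval_imageP.
  by exists (P - Q); rewrite ?rpredB ?hornerD ?hornerN.
- move=> x y /eval_imageP[P PS ->] /eval_imageP[Q QS ->]; apply/eval_imageP.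
  by exists (P * Q); rewrite ?rpredM ?hornerM.
- by move=> x xG; apply/eval_imageP; exists x%:P; rewrite ?hornerC ?polyOverC.
- by apply/eval_imageP; exists 'X; rewrite ?polyOverX ?hornerX.
Qed.

Lemma partial_hom_adjoin_graph (K : fieldType) (L : numClosedFieldType)
    (iota : {rmorphism rat -> K}) (G : {pred K * L}) (b : K) :
  algebraic_ext iota -> partial_hom G ->
  (forall c, (iota c, ratr c) \in G) ->
  exists G' : {pred K * L}, [/\ partial_hom G', {subset G <= G'} &
    exists r, (b, r) \in G'].
Proof.
move=> Kalg Ghom Grat.
have [r rP] := partial_hom_adjoin Ghom Grat b Kalg.
have [G'ring GG' brG'] := @eval_image_subring _ G (b, r) (proj1 Ghom).
exists (eval_image G (b, r)); split; [split=> //|by []|by exists r].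
move=> y /eval_imageP[P PS yE].
have Pb : root (map_poly fst P) b.
  by apply/rootP; rewrite (horner_map fst P (b, r)) -yE.
by move: yE; rewrite (rP P PS Pb) => -[].
Qed.

(** By Zorn's lemma there is a maximal graph above G0, and it is defined on all
    of K because another element could be adjoined otherwise. *)
Lemma partial_hom_extends (K : fieldType) (L : numClosedFieldType)
    (iota : {rmorphism rat -> K}) (G0 : {pred K * L}) :
  algebraic_ext iota -> partial_hom G0 ->
  (forall c, (iota c, ratr c) \in G0) ->
  exists s : {rmorphism K -> L}, forall x y, (x, y) \in G0 -> s x = y.
Proof.
move=> Kalg G0hom G0rat.
pose above (G : set (K * L)) :=
  [set` G0] `<=` G /\ partial_hom (mem G : {pred K * L}).
(* Zorn's lemma is stated for unions of arbitrary chains, including the empty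
   one, so the empty set has to be admitted besides the graphs above G0. *)
have [G [Gok Gmax]] : exists G, (G = set0 \/ above G) /\
    forall B, G `<` B -> ~ (B = set0 \/ above B).
  apply: (@Zorn_bigcup _ (fun G => G = set0 \/ above G)) => F FP Ftot.
  have [[G1 FG1 G1ok]|noF] := pselect (exists2 G, F G & above G); last first.
    left; rewrite -subset0 => x [X FX Xx].
    by have [X0|Xok] := FP _ FX; [rewrite -X0|case: noF; exists X].
  have up x : (\bigcup_(X in F) X) x -> exists G, [/\ F G, above G & G x].
    move=> [X FX Xx]; have [X0|Xok] := FP _ FX; last by exists X.
    by move: Xx; rewrite X0.
  have up2 x y : (\bigcup_(X in F) X) x -> (\bigcup_(X in F) X) y ->
      exists G, [/\ F G, above G, G x & G y].
    move=> /up[G [FG Gok Gx]] /up[H [FH Hok Hy]].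
    have [GH|HG] := Ftot _ _ FG FH.
      by exists H; split=> //; exact: GH.
    by exists G; split=> //; exact: HG.
  right; split; first by move=> x G0x; exists G1 => //; apply: G1ok.1.
  split; first split.
  - rewrite inE; exists G1 => //; have [_ [[G11 _ _] _]] := G1ok.
    by move: G11; rewrite inE.
  - move=> x y; rewrite !inE => Fx Fy; have [H [FH Hok Hx Hy]] := up2 _ _ Fx Fy.
    have [[_ HB _] _] := Hok.2; exists H => //; rewrite -inE.
    by apply: HB; rewrite inE.
  - move=> x y; rewrite !inE => Fx Fy; have [H [FH Hok Hx Hy]] := up2 _ _ Fx Fy.
    have [[_ _ HM] _] := Hok.2; exists H => //; rewrite -inE.
    by apply: HM; rewrite inE.
  - move=> y; rewrite inE => /up[H [FH Hok Hy]].
    by apply: (Hok.2.2); rewrite inE.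
have {Gok} [GG0 Ghom] : above G.
  case: Gok => // GE; exfalso; apply: (Gmax [set` G0]).
    rewrite GE; split; first by move=> x [].
    by move=> /(_ 1); apply; by have [[]] := G0hom.
  right; split=> //; suff <- : G0 = mem [set` G0] by [].
  by apply/funext => x; apply/idP/idP; rewrite inE.
have Gtot b : exists r, G (b, r).
  have Grat c : (iota c, ratr c) \in (mem G : {pred K * L}).
    by rewrite inE; apply: GG0; exact: G0rat.
  have [G' [G'hom G'G [r G'r]]] := partial_hom_adjoin_graph b Kalg Ghom Grat.
  apply: contrapT => nGb; apply: (Gmax [set` G']).
    split; first by move=> x Gx; apply: G'G; rewrite inE.
    by move=> /(_ (b, r) G'r) Gr; apply: nGb; exists r.
  right; split.
    by move=> x /GG0 Gx; apply: G'G; rewrite inE.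
  suff <- : G' = mem [set` G'] by [].
  by apply/funext => x; apply/idP/idP; rewrite inE.
have [[G1 GB GM] Gfun] := Ghom.
have Guniq x y z : G (x, y) -> G (x, z) -> y = z.
  move=> Gy Gz; apply/eqP; rewrite -subr_eq0; apply/eqP/Gfun.
  have -> : (0, y - z) = (x, y) - (x, z) :> K * L.
    by congr pair; rewrite subrr.
  by apply: GB; rewrite inE.
pose s b := projT1 (cid (Gtot b)).
have sG b : G (b, s b) by rewrite /s; case: cid.
have sB : zmod_morphism s.
  move=> x y; apply: (Guniq (x - y)) => //; rewrite -inE.
  by apply: (GB (x, s x) (y, s y)); rewrite inE.
have sM : monoid_morphism s.
  split=> [|x y]; first by apply: (Guniq 1) => //; move: G1; rewrite inE.
  apply: (Guniq (x * y)) => //; rewrite -inE.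
  by apply: (GM (x, s x) (y, s y)); rewrite inE.
pose s' : {rmorphism K -> L} := HB.pack s (GRing.isZmodMorphism.Build K L s sB)
  (GRing.isMonoidMorphism.Build K L s sM).
by exists s' => x y G0xy; apply: (Guniq x) => //; exact: GG0.
Qed.

Lemma Qadj_rat (K : fieldType) (a : K) (iota : {rmorphism rat -> K}) c :
  exists x : Qadj a, val x = iota c.
Proof.
suff cQ : iota c \in adjoin a by exists (MkQadj cQ).
rewrite -[c]divq_num_den rmorphM fmorphV !rmorph_int.
by rewrite rpred_div ?rpred_int.
Qed.

(** The value of s at x depends only on the restriction of s to Q(x), which is
    real as K is totally real. *)
Lemma totally_real_corestrict (R : realType) (K : fieldType)
    (iota : {rmorphism rat -> K}) (s : {rmorphism K -> R[i]}) :
  totally_real R iota ->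
  exists t : {rmorphism K -> R}, forall x, real_complex R (t x) = s x.
Proof.
move=> [_ Kreal].
have sreal x : exists r, s x = real_complex R r.
  exact: (Kreal x (s \o val : {rmorphism Qadj x -> R[i]}) (Qgen x)).
pose t x := complex.Re (s x).
have tE x : real_complex R (t x) = s x.
  by have [r rE] := sreal x; rewrite /t rE.
have inj := fmorph_inj (real_complex R).
have tB : zmod_morphism t.
  by move=> x y; apply: inj; rewrite rmorphB /= !tE rmorphB.
have tM : monoid_morphism t.
  split=> [|x y]; first by rewrite /t rmorph1.
  apply: inj; apply: etrans (tE _) _; rewrite rmorphM -!tE.
  exact/esym/(rmorphM (real_complex R)).
pose t' : {rmorphism K -> R} := HB.pack t
  (GRing.isZmodMorphism.Build K R t tB) (GRing.isMonoidMorphism.Build K R t tM).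
by exists t'; exact: tE.
Qed.

(** The graph of s0 is extended inside K * R[i], where the polynomials that
    arise have roots; that K is totally real brings the values back to R. *)
Lemma real_embedding_extends (R : realType) (K : fieldType)
    (iota : {rmorphism rat -> K}) (a : K) (s0 : {rmorphism Qadj a -> R}) :
  totally_real R iota ->
  exists s : {rmorphism K -> R}, s a = s0 (Qgen a).
Proof.
move=> Kreal.
pose t0 : {rmorphism Qadj a -> R[i]} := real_complex R \o s0.
pose G0 : {pred K * R[i]} := fun z => `[< exists x, z = (val x, t0 x) >].
have G0P z : reflect (exists x : Qadj a, z = (val x, t0 x)) (z \in G0).
  exact: asboolP.
have [||s sE] := @partial_hom_extends K R[i] iota G0 (proj1 Kreal).
- split; first split.
  + by apply/G0P; exists 1; rewrite !rmorph1.
  + by move=> _ _ /G0P[x ->] /G0P[y ->]; apply/G0P; exists (x - y);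
      rewrite !rmorphB.
  + by move=> _ _ /G0P[x ->] /G0P[y ->]; apply/G0P; exists (x * y);
      rewrite !rmorphM.
  + move=> y /G0P[x [x0 ->]].
    have -> : x = 0 by apply: val_inj; rewrite rmorph0; exact: esym x0.
    by rewrite rmorph0.
- move=> c; apply/G0P; have [x xE] := Qadj_rat a iota c; exists x.
  rewrite xE; congr pair.
  suff -> : x = ratr c by rewrite fmorph_rat.
  apply: val_inj; rewrite xE fmorph_eq_rat; apply: esym.
  exact: (fmorph_rat (val : {rmorphism Qadj a -> K})).
have [t tE] := totally_real_corestrict s Kreal.
exists t; apply: (fmorph_inj (real_complex R)); apply: etrans (tE a) _.
by apply: sE; apply/G0P; exists (Qgen a).
Qed.

(** The graph of the inclusion of Q in R[i] is extended. Without an embedding,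
    every element, 0 included, would be totally positive. *)
Lemma real_embedding_exists (R : realType) (K : fieldType)
    (iota : {rmorphism rat -> K}) :
  totally_real R iota -> exists s : {rmorphism K -> R}, True.
Proof.
move=> Kreal.
pose G0 : {pred K * R[i]} := fun z => `[< exists c, z = (iota c, ratr c) >].
have G0P z : reflect (exists c, z = (iota c, ratr c)) (z \in G0).
  exact: asboolP.
have [||s _] := @partial_hom_extends K R[i] iota G0 (proj1 Kreal).
- split; first split.
  + by apply/G0P; exists 1; rewrite !rmorph1.
  + by move=> _ _ /G0P[x ->] /G0P[y ->]; apply/G0P; exists (x - y);
      rewrite !rmorphB.
  + by move=> _ _ /G0P[x ->] /G0P[y ->]; apply/G0P; exists (x * y);
      rewrite !rmorphM.
  + move=> y /G0P[x [/esym/eqP x0 ->]].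
    by move: x0; rewrite fmorph_eq0 => /eqP ->; rewrite rmorph0.
- by move=> c; apply/G0P; exists c.
by have [t _] := totally_real_corestrict s Kreal; exists t.
Qed.

(** * Subfields of finite degree *)

Definition rat_span (K : fieldType) (iota : rat -> K) (e : seq K) : {pred K} :=
  fun x => `[< exists c : nat -> rat, x = \sum_(i < size e) iota (c i) * e`_i >].

Section RatSpan.
Variables (K : fieldType) (iota : {rmorphism rat -> K}) (e : seq K).

Lemma rat_spanP x :
  reflect (exists c : nat -> rat, x = \sum_(i < size e) iota (c i) * e`_i)
    (x \in rat_span iota e).
Proof. exact: asboolP. Qed.

Lemma rat_spanD : {in rat_span iota e &, forall x y, x + y \in rat_span iota e}.
Proof.
move=> _ _ /rat_spanP[c ->] /rat_spanP[d ->]; apply/rat_spanP.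
exists (fun i => c i + d i); rewrite -big_split /=.
by apply: eq_bigr => i _; rewrite rmorphD mulrDl.
Qed.

Lemma rat_spanZ a x : x \in rat_span iota e -> iota a * x \in rat_span iota e.
Proof.
move=> /rat_spanP[c ->]; apply/rat_spanP; exists (fun i => a * c i).
by rewrite mulr_sumr; apply: eq_bigr => i _; rewrite rmorphM mulrA.
Qed.

Lemma rat_span0 : 0 \in rat_span iota e.
Proof.
by apply/rat_spanP; exists (fun=> 0); rewrite big1 // => i _; rewrite rmorph0 mul0r.
Qed.

Lemma rat_span_sum (I : Type) (r : seq I) (F : I -> K) :
  (forall i, F i \in rat_span iota e) -> \sum_(i <- r) F i \in rat_span iota e.
Proof. by move=> hF; elim/big_ind: _ => //; [exact: rat_span0|exact: rat_spanD]. Qed.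

Lemma rat_span_mem x : x \in e -> x \in rat_span iota e.
Proof.
move=> xe; apply/rat_spanP; exists (fun i => (i == index x e)%:R).
have lt_x : (index x e < size e)%N by rewrite index_mem.
rewrite (bigD1 (Ordinal lt_x)) //= eqxx rmorph1 mul1r nth_index //.
rewrite big1 ?addr0 // => i /negP ix; case: eqP => [E|_]; last by rewrite rmorph0 mul0r.
by case: ix; apply/eqP/val_inj.
Qed.
End RatSpan.

(** Reduce X^k modulo a polynomial that vanishes at a. *)
Lemma algebraic_power_reduce (K : fieldType) (iota : {rmorphism rat -> K})
    (a : K) :
  algebraicOver iota a ->
  exists d : nat, forall k, exists q : {poly rat},
    (size q <= d)%N /\ a ^+ k = (map_poly iota q).[a].
Proof.
move=> [p p0 pa]; exists (size p) => k; exists ('X^k %% p); split.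
  by rewrite ltnW // ltn_modp.
rewrite -[LHS]hornerXn -(map_polyXn iota) {1}(divp_eq 'X^k p).
by rewrite rmorphD rmorphM hornerD hornerM (rootP pa) mulr0 add0r.
Qed.

(** A spanning family is formed by the products x a^i, where x runs over a
    spanning family of F and i stays below the bound of
    [algebraic_power_reduce]. *)
Lemma finite_span_adjoin (K : fieldType) (iota : {rmorphism rat -> K})
    (F : {pred K}) (e : seq K) (a : K) :
  algebraicOver iota a -> {subset F <= rat_span iota e} ->
  exists e', {subset eval_image F a <= rat_span iota e'}.
Proof.
move=> /algebraic_power_reduce[d aE] Fe.
exists [seq x * a ^+ i | x <- e, i <- seq.iota 0 d].
move=> _ /eval_imageP[P PF ->].
rewrite horner_coef; apply: rat_span_sum => k.
have /Fe /rat_spanP[c ->] : P`_k \in F by apply: (allP PF); rewrite mem_nth.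
rewrite mulr_suml; apply: rat_span_sum => i; rewrite -mulrA.
apply: rat_spanZ; have [q [qd ->]] := aE k.
rewrite horner_coef mulr_sumr; apply: rat_span_sum => j.
rewrite coef_map /= mulrCA; apply: rat_spanZ; apply: rat_span_mem.
apply: allpairs_f; first exact: mem_nth.
have jd : (j < d)%N by rewrite (leq_trans _ qd) // (leq_trans (ltn_ord j)) ?size_poly.
by rewrite mem_iota.
Qed.

Lemma finite_subring (K : fieldType) (iota : {rmorphism rat -> K}) (s : seq K) :
  algebraic_ext iota ->
  exists (F : {pred K}) (e : seq K), [/\ subring_closed F,
    forall c, iota c \in F, {subset s <= F} & {subset F <= rat_span iota e}].
Proof.
move=> Kalg; elim: s => [|a s [F [e [Fring Frat sF Fe]]]].
  exists (fun x => `[< exists c, x = iota c >]), [:: 1]; split=> //.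
  - split; first by apply/asboolP; exists 1; rewrite rmorph1.
    + by move=> _ _ /asboolP[c ->] /asboolP[d ->]; apply/asboolP;
        exists (c - d); rewrite rmorphB.
    + by move=> _ _ /asboolP[c ->] /asboolP[d ->]; apply/asboolP;
        exists (c * d); rewrite rmorphM.
  - by move=> c; apply/asboolP; exists c.
  - move=> _ /asboolP[c ->]; rewrite -[iota c]mulr1.
    by apply: rat_spanZ; apply: rat_span_mem; rewrite inE.
have [F'ring FF' aF'] := @eval_image_subring _ F a Fring.
have [e' F'e'] := finite_span_adjoin (Kalg a) Fe.
exists (eval_image F a), e'; split=> //.
- by move=> c; apply: FF'.
- by move=> x; rewrite inE => /predU1P[->//|/sF]; exact: FF'.
Qed.

(** Q[s] is a subring of finite dimension over Q; it is a field because its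
    elements are algebraic, and it cannot be K because K is infinite. *)
Lemma infinite_ext_proper_subfield (K : fieldType)
    (iota : {rmorphism rat -> K}) (s : seq K) :
  algebraic_ext iota -> infinite_ext iota ->
  exists F : {pred K}, [/\ divring_closed F, {subset s <= F}
    & exists x, x \notin F].
Proof.
move=> Kalg Kinf; have [F [e [Fring Frat sF Fe]]] := finite_subring s Kalg.
exists F; split=> //; last first.
  apply: contrapT => noF; apply: Kinf; exists (size e), (fun i => e`_i) => a.
  have /Fe /rat_spanP[c ->] : a \in F.
    by apply: contrapT => /negP aF; apply: noF; exists a.
  by exists (fun i => c i).
have [F1 FB FM] := Fring; split=> // x y xF yF; apply: FM => //.
have [->|y0] := eqVneq y 0; first by rewrite invr0 -(rmorph0 iota).
have [q q0 qy] := algebraic_nonzero_root (Kalg y) y0.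
have [v vF yv] := subring_inverse Fring Frat yF q0 qy.
suff -> : y^-1 = v by [].
by rewrite -[y^-1]mulr1 -yv mulKf.
Qed.

(** * Conjugates, house and total positivity *)

(** An embedding sends a to a root of a fixed rational polynomial. *)
Lemma embedding_values (R : realType) (K : fieldType)
    (iota : {rmorphism rat -> K}) (a : K) :
  algebraicOver iota a ->
  exists l : seq R, forall s : {rmorphism K -> R}, s a \in l.
Proof.
move=> [p p0 pa]; exists (rootsR (map_poly ratr p)) => s.
have -> : s a \in rootsR (map_poly ratr p) = root (map_poly ratr p) (s a).
  by rewrite -roots_on_rootsR ?map_poly_eq0 // in_itv.
have -> : map_poly ratr p = map_poly s (map_poly iota p).
  rewrite -map_poly_comp; apply: eq_map_poly => c /=.
  by rewrite [iota c]fmorph_eq_rat fmorph_rat.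
exact: rmorph_root.
Qed.

Lemma embedding_bound (R : realType) (K : fieldType)
    (iota : {rmorphism rat -> K}) (a : K) :
  algebraicOver iota a ->
  exists N : nat, forall s : {rmorphism K -> R}, `|s a| <= N%:R.
Proof.
move=> /(embedding_values R)[l sl].
have [N lN] : exists N : nat, {in l, forall x, `|x| <= N%:R}.
  elim: l {sl} => [|y l [N lN]]; first by exists 0%N.
  exists (Num.bound `|y| + N)%N => x; rewrite inE natrD => /predU1P[->|/lN xN].
    by rewrite (le_trans (ltW (archi_boundP _))) // lerDl.
  by rewrite (le_trans xN) // lerDr.
by exists N => s; exact: lN.
Qed.

Lemma house_le (R : realType) (K : fieldType) (iota : {rmorphism rat -> K})
    (a : K) (B : R) :
  totally_real R iota -> 0 <= B ->
  (forall s : {rmorphism K -> R}, `|s a| <= B) -> house R a <= B.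
Proof.
move=> Kreal B0 aB; rewrite /house.
set E := [set r | _].
have [E0|nE] := pselect (E !=set0); last first.
  suff -> : E = set0 by rewrite sup0.
  by rewrite -subset0 => x Ex; apply: nE; exists x.
apply: ge_sup => // _ [s0 ->].
by have [s <-] := real_embedding_extends s0 Kreal.
Qed.

Lemma totally_positive_embeddings (R : realType) (K : fieldType)
    (iota : {rmorphism rat -> K}) (a : K) :
  totally_real R iota -> (forall s : {rmorphism K -> R}, 0 < s a) ->
  totally_positive R a.
Proof.
move=> Kreal apos s0; have [s <-] := real_embedding_extends s0 Kreal.
exact: apos.
Qed.

(** Each coefficient takes finitely many values under the embeddings, by
    [embedding_values]. *)
Lemma map_mpoly_finite (R : realType) (K : fieldType)
    (iota : {rmorphism rat -> K}) (n : nat) (P : {mpoly K[n]}) :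
  algebraic_ext iota ->
  exists l : seq {mpoly R[n]}, forall s : {rmorphism K -> R},
    map_mpoly s P \in l.
Proof.
move=> Kalg; elim/mpolyind: P => [|c k P _ _ [l sl]].
  by exists [:: 0] => s; rewrite raddf0 inE.
have [lc scl] := embedding_values R (Kalg c).
exists [seq c' *: 'X_[k] + p | c' <- lc, p <- l] => s.
rewrite rmorphD /= map_mpolyZ map_mpolyX.
exact: (allpairs_f (fun c' p => c' *: 'X_[k] + p)).
Qed.

Lemma meval_map_mpoly (R S : comNzRingType) (s : {rmorphism R -> S}) (n : nat)
    (P : {mpoly R[n]}) (x : 'I_n -> R) :
  (map_mpoly s P).@[fun i => s (x i)] = s P.@[x].
Proof.
elim/mpolyind: P => [|c k P _ _ IH]; first by rewrite raddf0 !meval0 rmorph0.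
rewrite rmorphD /= !mevalD IH map_mpolyZ map_mpolyX !mevalZ !mevalX.
rewrite rmorphD rmorphM rmorph_prod; congr (_ * _ + _).
by apply: eq_bigr => i _; rewrite rmorphXn.
Qed.

Lemma map_mpoly_homog (K L : fieldType) (s : {rmorphism K -> L}) (n m : nat)
    (P : {mpoly K[n]}) :
  P \is m.-homog -> map_mpoly s P \is m.-homog.
Proof.
move=> /dhomogP Phom; apply/dhomogP => k.
by rewrite (perm_mem (msupp_map_mpoly _ (fmorph_inj s))) => /Phom.
Qed.

(** The point is that C does not depend on the embedding: it is the minimum of
    the constants of the finitely many conjugate forms. *)
Lemma totally_posdef_lower_bound (R : realType) (K : fieldType)
    (iota : {rmorphism rat -> K}) (m n : nat) (P : {mpoly K[n]}) :
  algebraic_ext iota -> (0 < m)%N -> P \is m.-homog ->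
  (forall (s : {rmorphism K -> R}) (x : 'I_n -> R),
      (exists i, x i != 0) -> 0 < (map_mpoly s P).@[x]) ->
  exists2 C : R, 0 < C & forall (s : {rmorphism K -> R}) (x : 'I_n -> K) i,
    C * `|s (x i)| ^+ m <= s P.@[x].
Proof.
move=> Kalg m0 Phom Ppos; have [l sl] := map_mpoly_finite R P Kalg.
suff [C C0 hC] : exists2 C : R, 0 < C & forall s : {rmorphism K -> R},
    map_mpoly s P \in l -> forall x i, C * `|x i| ^+ m <= (map_mpoly s P).@[x].
  exists C => // s x i; have := hC s (sl s) (fun j => s (x j)) i.
  by rewrite meval_map_mpoly.
elim: l {sl} => [|p l [C C0 hC]]; first by exists 1.
(* Polynomials of the list that are not conjugates of P need not be positive,
   and contribute no constant. *)
have [[s0 s0p]|nop] := pselect (exists s0 : {rmorphism K -> R}, map_mpoly s0 P = p);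
  last first.
  exists C => // s; rewrite inE => /predU1P[sp|]; last exact: hC.
  by case: nop; exists s.
have phom : p \is m.-homog by rewrite -s0p map_mpoly_homog.
have [|C' C'0 hC'] := posdef_form_lower_bound m0 phom.
  by move=> y; rewrite -s0p; exact: Ppos.
exists (Num.min C C') => [|s]; first by rewrite lt_min C0.
rewrite inE => /predU1P[->|/hC sC] x i.
  by rewrite (le_trans _ (hC' x i)) // ler_wpM2r ?exprn_ge0 // ge_min lexx orbT.
by rewrite (le_trans _ (sC x i)) // ler_wpM2r ?exprn_ge0 // ge_min lexx.
Qed.

(** * The descent *)

Lemma common_denominator (K : fieldType) (Ord : {pred K}) (xs : seq K) :
  is_order Ord ->
  exists d, [/\ d \in Ord, d != 0 & {in xs, forall x, d * x \in Ord}].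
Proof.
move=> [[O1 OB OM] _ Ofrac]; elim: xs => [|x xs [d [dO d0 dxs]]].
  by exists 1; rewrite oner_eq0.
have [a [b [aO bO b0 xE]]] := Ofrac x.
exists (b * d); split; [exact: OM|by rewrite mulf_neq0|].
move=> y; rewrite inE => /predU1P[->|/dxs dy]; last by rewrite -mulrA OM.
have -> : b * d * x = d * a by rewrite xE; field.
by rewrite OM.
Qed.

Lemma lattice_coord_denominator (K : fieldType) (Ord : {pred K})
    (V : vectType K) (L : set V) :
  is_order Ord -> fg_submodule Ord L ->
  exists d, [/\ d \in Ord, d != 0 &
    forall v, L v -> forall j, d * coord (vbasis {:V}) j v \in Ord].
Proof.
move=> Oord [n [e ->]].
have [d [dO d0 dP]] := common_denominator
  [seq coord (vbasis {:V}) j (e i) | i <- enum 'I_n, j <- enum 'I_(\dim {:V})] Oord.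
exists d; split=> // _ [c [cO ->]] j.
have [Oring _ _] := Oord.
pose S : subringClosed K := HB.pack Ord (GRing.isSubringClosed.Build K Ord Oring).
rewrite -[Ord]/(S : {pred K}) linear_sum mulr_sumr rpred_sum // => i _.
rewrite linearZ /= mulrCA; have [_ _ OM] := Oring; apply: OM; first exact: cO.
by apply: dP; apply: allpairs_f; rewrite mem_enum.
Qed.

Lemma meval_subring (K : fieldType) (F : {pred K}) (n : nat) (P : {mpoly K[n]})
    (x : 'I_n -> K) :
  subring_closed F -> (forall k, P@_k \in F) -> (forall i, x i \in F) ->
  P.@[x] \in F.
Proof.
move=> Fring PF xF.
pose S : subringClosed K := HB.pack F (GRing.isSubringClosed.Build K F Fring).
rewrite mevalE -[F]/(S : {pred K}) rpred_sum // => k _; apply: rpredM.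
  exact: PF.
by apply: rpred_prod => i _; apply: rpredX; exact: xF.
Qed.

(** The coordinates of a vector representing delta a have conjugates of the
    order of magnitude of the m-th root of those of a, uniformly in the
    embedding. The factor d will clear the denominators of x. *)
Lemma representation_coord_bound (R : realType) (K : fieldType)
    (iota : {rmorphism rat -> K}) (m n : nat) (P : {mpoly K[n]}) (delta d : K) :
  algebraic_ext iota -> (0 < m)%N -> P \is m.-homog ->
  (forall (s : {rmorphism K -> R}) (x : 'I_n -> R),
      (exists i, x i != 0) -> 0 < (map_mpoly s P).@[x]) ->
  exists E : nat, forall (s : {rmorphism K -> R}) (x : 'I_n -> K) (a : K) (H : R),
    P.@[x] = delta * a -> `|s a| <= H ->
    forall i, `|s (d * x i)| ^+ m <= E%:R * H.
Proof.
move=> Kalg m0 Phom Ppos.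
have [C C0 PC] := totally_posdef_lower_bound Kalg m0 Phom Ppos.
have [M sd] := embedding_bound R (Kalg d).
have [N sdelta] := embedding_bound R (Kalg delta).
(* M and N bound the conjugates of d and delta. *)
exists (M ^ m * N * Num.bound C^-1)%N => s x a H Px aH i.
have H0 : 0 <= H by rewrite (le_trans _ aH).
have /(_ s x i) := PC; rewrite Px rmorphM => Cx.
have {}Cx : `|s (x i)| ^+ m <= C^-1 * (N%:R * H).
  rewrite -ler_pdivrMl ?invr_gt0 // invrK (le_trans Cx) //.
  rewrite (le_trans (ler_norm _)) // normrM.
  by rewrite ler_pM.
rewrite rmorphM normrM exprMn !natrM natrX -!mulrA ler_pM ?exprn_ge0 //.
  by rewrite lerXn2r ?nnegrE.
rewrite (le_trans Cx) // mulrCA ler_wpM2l // ler_wpM2r //.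
by rewrite ltW // archi_boundP // invr_ge0 ltW.
Qed.

(** If 3 y > H then y > 1, so E H >= y^m >= y^2 > (H / 3)^2, that is H < 9 E,
    against the last hypothesis. The summand 9 ensures that H / 3 >= 1 and
    leaves room in the descent for rounding H / 3 up to an integer. *)
Lemma root_bound_third (R : realType) (m E H : nat) (y : R) :
  (1 < m)%N -> 0 <= y -> y ^+ m <= E%:R * H%:R -> (9 * E + 9 <= H)%N ->
  3 * y <= H%:R.
Proof.
move=> m1 y0 ym EH; rewrite leNgt; apply/negP => Hy.
have EH' : 9 * E%:R + 9 <= H%:R :> R by rewrite -natrM -natrD ler_nat.
have E0 : 0 <= E%:R :> R by [].
have y1 : 1 <= y by lra.
have y2 : y ^+ 2 <= y ^+ m by rewrite ler_weXn2l.
nra.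
Qed.

(** The bound B is chosen before the subfield F, which is essential: F will
    later be made to contain all totally positive elements below this bound. *)
Lemma small_totally_positive_outside (R : realType) (K : fieldType)
    (iota : {rmorphism rat -> K}) (Ord : {pred K}) (m n : nat)
    (P : {mpoly K[n]}) (delta d : K) :
  totally_real R iota -> subring_closed Ord -> (1 < m)%N -> P \is m.-homog ->
  (forall (s : {rmorphism K -> R}) (x : 'I_n -> R),
      (exists i, x i != 0) -> 0 < (map_mpoly s P).@[x]) ->
  delta != 0 -> d != 0 ->
  (forall a, pos_part R [set` Ord] a ->
     exists2 x : 'I_n -> K, P.@[x] = delta * a & forall i, d * x i \in Ord) ->
  exists B : nat, forall F : {pred K},
    divring_closed F -> (forall k, P@_k \in F) -> delta \in F -> d \in F ->
    (exists2 a, a \in Ord & a \notin F) ->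
    exists2 b, b \notin F & pos_part R [set` Ord] b /\
      forall s : {rmorphism K -> R}, `|s b| <= B%:R.
Proof.
move=> Kreal Oring m1 Phom Ppos delta0 d0 repr.
have m0 : (0 < m)%N by exact: ltnW.
have [E EP] := representation_coord_bound delta d (proj1 Kreal) m0 Phom Ppos.
exists (9 * E + 9)%N => F Fdiv PF deltaF dF [a0 a0O a0F].
pose S : divringClosed K := HB.pack F (GRing.isDivringClosed.Build K F Fdiv).
pose O : subringClosed K :=
  HB.pack Ord (GRing.isSubringClosed.Build K Ord Oring).
have shift_notin N a : a \notin F -> N%:R + a \notin F.
  apply: contra => aF; rewrite -[F]/(S : {pred K}) -(addKr N%:R a).
  by rewrite rpredD ?rpredN ?rpred_nat.
have shift_Ord N a : a \in Ord -> N%:R + a \in Ord.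
  by move=> aO; rewrite -[Ord]/(O : {pred K}) rpredD ?rpred_nat.
have shift_pos (N : nat) a : a \in Ord ->
    (forall s : {rmorphism K -> R}, `|s a| < N%:R) ->
    pos_part R [set` Ord] (N%:R + a).
  move=> aO aN; split; first exact: shift_Ord.
  apply: (totally_positive_embeddings Kreal) => s.
  rewrite rmorphD rmorph_nat; have := aN s; rewrite ltr_norml => /andP[aN' _].
  by rewrite -ltrBlDl sub0r.
have descent H a : a \notin F -> pos_part R [set` Ord] a ->
    (forall s : {rmorphism K -> R}, `|s a| <= H%:R) ->
    exists2 b, b \notin F & pos_part R [set` Ord] b /\
      forall s : {rmorphism K -> R}, `|s b| <= (9 * E + 9)%N%:R.
  elim: H a => [|H IH] a aF apos aH.
    by exists a => //; split=> // s; rewrite (le_trans (aH s)) // ler_nat.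
  have [EH|HE] := leqP (9 * E + 9) H.+1; last first.
    by exists a => //; split=> // s; rewrite (le_trans (aH s)) // ler_nat ltnW.
  have [x Px xO] := repr a apos.
  have [i xiF] : exists i, d * x i \notin F.
    apply: contrapT => noi; move/negP: aF; apply.
    have -> : a = delta^-1 * P.@[x] by rewrite Px mulKf.
    have xF i : x i \in F.
      have dxF : d * x i \in F by apply: contrapT => /negP dxF; apply: noi; exists i.
      by rewrite -[F]/(S : {pred K}) -[x i](mulKf d0) rpredM ?rpredV.
    rewrite -[F]/(S : {pred K}) rpredM ?rpredV //.
    apply: meval_subring => //; have [F1 FB _] := Fdiv; split=> // u w uF wF.
    exact: rpredM.
  have dxH (s : {rmorphism K -> R}) : 3 * `|s (d * x i)| <= H.+1%:R.
    by apply: (@root_bound_third R m E) => //; exact: (EP s x a _ Px (aH s) i).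
  (* H / 3 < N <= H / 3 + 1 for the current bound H, so the conjugates of
     N + d x_i lie between 0 and 2 H / 3 + 1 <= H - 1. *)
  pose N := (H.+1 %/ 3).+1.
  have N1 : H.+1%:R < 3 * N%:R :> R by rewrite -natrM ltr_nat /N; lia.
  have N2 : 3 * N%:R <= H.+1%:R + 3 :> R by rewrite -natrM -natrD ler_nat /N; lia.
  have H5 : 9 <= H.+1%:R :> R by rewrite ler_nat; lia.
  apply: (IH (N%:R + d * x i)).
  - exact: shift_notin.
  - by apply: shift_pos => // s; have := dxH s; lra.
  - move=> s; rewrite rmorphD rmorph_nat.
    rewrite (le_trans (ler_normD _ _)) // normr_nat.
    by have := dxH s; rewrite -natr1 in N1 N2 H5 *; lra.
(* The descent starts from a translate of a0, made totally positive by a large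
   integer. *)
have [N sa0] := embedding_bound R (proj1 Kreal a0).
have [M sb0] := embedding_bound R (proj1 Kreal (N.+1%:R + a0)).
apply: (descent M (N.+1%:R + a0)) => //; first exact: shift_notin.
by apply: shift_pos => // s; rewrite (le_lt_trans (sa0 s)) // ltr_nat.
Qed.

(** * Failure of the Northcott property *)

Unset Implicit Arguments.

Theorem theorem1p2 (R : realType) (m : nat) (K : fieldType)
    (iota : {rmorphism rat -> K}) (delta : K) (Ord : {pred K}) :
  (2 <= m)%N -> ~~ odd m ->
  totally_real R iota -> infinite_ext iota ->
  pos_part R (integers K) delta ->
  is_order Ord ->
  (exists (V : vectType K) (L : set V) (Q : V -> K),
     [/\ mic_lattice m Ord L Q,
         totally_posdef R m Q
       & forall b : K, pos_part R [set` Ord] b -> represents L Q (delta * b)]) ->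
  ~ northcott R (pos_part R [set` Ord]).
Proof.
move=> m2 _ Kreal Kinf [_ delta_pos] Oord.
move=> [V [L [Q [[Lfg _ _] [P [Phom PE] Ppos] repr]]]] north.
have delta0 : delta != 0.
  have [s _] := real_embedding_exists Kreal.
  have := delta_pos (s \o val : {rmorphism Qadj delta -> R}).
  by apply: contraTneq => /= ->; rewrite rmorph0 ltxx.
have [d [dO d0 dL]] := lattice_coord_denominator Oord Lfg.
have [Oring _ Ofrac] := Oord.
have [|B BP] :=
  small_totally_positive_outside Kreal Oring m2 Phom Ppos delta0 d0.
  move=> a /repr[v Lv Qv].
  exists (fun i => coord (vbasis {:V}) i v); last exact: dL.
  by rewrite -PE -Qv -coord_vbasis ?memvf.
have /finite_seqP[T TE] := north B.+1%:R (ltr0Sn R B).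
(* T lists the totally positive elements of the order of house < B + 1. *)
have [F [Fdiv sF [x xF]]] := infinite_ext_proper_subfield
  (delta :: d :: [seq P@_k | k <- msupp P] ++ T) (proj1 Kreal) Kinf.
pose S : divringClosed K := HB.pack F (GRing.isDivringClosed.Build K F Fdiv).
have PF k : P@_k \in F.
  have [kP|kP] := boolP (k \in msupp P).
    have Pk : P@_k \in [seq P@_i | i <- msupp P] by exact: map_f.
    by apply: sF; rewrite !inE mem_cat Pk !orbT.
  by rewrite memN_msupp_eq0 // -[F]/(S : {pred K}) rpred0.
have [|||b bF [bpos bB]] := BP F Fdiv PF.
- by apply: sF; rewrite inE eqxx.
- by apply: sF; rewrite !inE eqxx orbT.
- have [y [z [yO zO z0 xyz]]] := Ofrac x.
  have [yF|yF] := boolP (y \in F); last by exists y.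
  exists z => //; apply: contra xF => zF.
  by rewrite xyz -[F]/(S : {pred K}) rpred_div.
move/negP: bF; apply; apply: sF; rewrite !inE mem_cat; apply/orP; right.
apply/orP; right; apply/orP; right.
suff : [set` T] b by [].
rewrite -TE; split=> //; apply: le_lt_trans (house_le Kreal _ bB) _ => //.
by rewrite ltr_nat.
Qed.
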